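(* Let $\mathcal{L}\subseteq\mathbb{Z}^3$ be an order ideal with $\mathcal{L}\subseteq C(0,0,0)$ and $\mathcal{U}\cap C(0,0,0)$ finite, let $\mathcal{I}$ be as in the context, and let $N$ be a cutoff for $\mathcal{I}$. Then every $\mathcal{I}$-grove within radius $N$ is acyclic.
   Context: For $(i,j,k)\in\mathbb{Z}^3$ let $C(i,j,k)=\{(i',j',k') : i'\le i,\ j'\le j,\ k'\le k\}$. $\mathcal{L}\subseteq\mathbb{Z}^3$ satisfies: $(i,j,k)\in\mathcal{L}\Rightarrow C(i,j,k)\subseteq\mathcal{L}$. $\mathcal{U}=\mathbb{Z}^3\setminus\mathcal{L}$, $\mathcal{I}=\{(i,j,k)\in\mathcal{L} : (i+1,j+1,k+1)\in\mathcal{U}\}$. A cutoff for $\mathcal{I}$ is an integer $N$ such that (i) $(i,j,k)\in\mathcal{I}$ whenever $i+j+k\le -N$ and $\max\{i,j,k\}=0$; (ii) $(i,j,k)\notin\mathcal{I}$ whenever $i+j+k\le -N-3$ and $\max\{i,j,k\}<0$. For $(i,j,k)\in\mathcal{I}$ let $r_a(i,j,k)=\{(i,j,k),(i,j-1,k),(i,j,k-1),(i,j-1,k-1)\}$, $r_b(i,j,k)=\{(i,j,k),(i-1,j,k),(i,j,k-1),(i-1,j,k-1)\}$, $r_c(i,j,k)=\{(i,j,k),(i-1,j,k),(i,j-1,k),(i-1,j-1,k)\}$; a rhombus is such a set contained in $\mathcal{I}$. Long edges: $e_a(i,j,k)=\{(i,j-1,k),(i,j,k-1)\}$, $e_b(i,j,k)=\{(i-1,j,k),(i,j,k-1)\}$,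 $e_c(i,j,k)=\{(i-1,j,k),(i,j-1,k)\}$; short edges: $e'_a(i,j,k)=\{(i,j,k),(i,j-1,k-1)\}$, $e'_b(i,j,k)=\{(i,j,k),(i-1,j,k-1)\}$, $e'_c(i,j,k)=\{(i,j,k),(i-1,j-1,k)\}$ (for the rhombus $r_a,r_b,r_c$ respectively). $\mathcal{G}$ is the graph on $\mathcal{I}$ whose edges are the long and short edges of all rhombi. An $\mathcal{I}$-grove within radius $N$ is a subgraph $G\subseteq\mathcal{G}$ with: vertex set all of $\mathcal{I}$; for every rhombus exactly one of its two edges in $G$; for every rhombus all of whose vertices satisfy $i+j+k<-N$, its short edge in $G$; and every component of $G$ contains exactly one of the following sets, each of which lies in some component: $\{(0,p,q),(p,0,q)\}$, $\{(p,q,0),(0,q,p)\}$, $\{(q,0,p),(q,p,0)\}$ for $0>p>q$, $p+q\in\{-N-1,-N-2\}$; $\{(0,p,p),(p,0,p),(p,p,0)\}$ for $2p\in\{-N-1,-N-2\}$; $\{(0,0,q)\},\{(0,q,0)\},\{(q,0,0)\}$ for $q\le -N-1$. *)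

(* Defs.v *)
From HB Require Import structures.
From mathcomp Require Import all_boot all_order all_algebra.
From mathcomp Require Import boolp classical_sets cardinality.
From mathcomp Require Import zify.

Set Implicit Arguments.
Unset Strict Implicit.
Unset Printing Implicit Defensive.

Import Order.TTheory GRing.Theory Num.Theory.
Local Open Scope classical_set_scope.
Local Open Scope ring_scope.

(* Possibly infinite simple graphs; an edge is the set of its two endpoints. *)
Record graph (T : Type) := Graph {
  vertices : set T;
  edges : set (set T);
  edges_wf : forall e, edges e ->
    exists u v, [/\ u <> v, vertices u, vertices v & e = [set u; v]]
}.

Definition subgraph (T : Type) (G H : graph T) : Prop :=
  vertices G `<=` vertices H /\ edges G `<=` edges H.

(* [adj] is boolean, by excluded middle, so that [path] and [ucycle] apply. *)
Definition adj (T : Type) (G : graph T) : rel T :=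
  fun u v => `[< edges G [set u; v] >].

Definition connected_in (T : Type) (G : graph T) (u v : T) : Prop :=
  exists2 p : seq T, path (adj G) u p & last u p = v.

Definition component (T : Type) (G : graph T) (K : set T) : Prop :=
  exists2 u, vertices G u & K = [set v | connected_in G u v].

(* [ucycle e c]: the entries of [c] are pairwise distinct and cyclically
   adjacent. The size bound excludes traversing a single edge back and forth. *)
Definition acyclic (T : eqType) (G : graph T) : Prop :=
  forall c : seq T, (2 < size c)%N -> ~ ucycle (adj G) c.

Notation Z3 := (int * int * int)%type.

Definition C (v : Z3) : set Z3 :=
  let: (i, j, k) := v in
  [set w : Z3 | let: (i', j', k') := w in [/\ i' <= i, j' <= j & k' <= k]].

Definition order_ideal (L : set Z3) : Prop := forall v, L v -> C v `<=` L.

Definition upper (L : set Z3) : set Z3 := ~` L.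

Definition initial (L : set Z3) : set Z3 :=
  [set v : Z3 | L v /\ let: (i, j, k) := v in upper L (i + 1, j + 1, k + 1)].

Definition coord_sum (v : Z3) : int := let: (i, j, k) := v in i + j + k.

Definition coord_max (v : Z3) : int :=
  let: (i, j, k) := v in Num.max i (Num.max j k).

Definition cutoff (I : set Z3) (N : int) : Prop :=
  (forall v, coord_sum v <= - N -> coord_max v = 0 -> I v) /\
  (forall v, coord_sum v <= - N - 3 -> coord_max v < 0 -> ~ I v).

Inductive direction := da | db | dc.

Definition rhombus (d : direction) (v : Z3) : set Z3 :=
  let: (i, j, k) := v in
  match d with
  | da => [set (i, j, k); (i, j - 1, k); (i, j, k - 1); (i, j - 1, k - 1)]
  | db => [set (i, j, k); (i - 1, j, k); (i, j, k - 1); (i - 1, j, k - 1)]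
  | dc => [set (i, j, k); (i - 1, j, k); (i, j - 1, k); (i - 1, j - 1, k)]
  end.

Definition long_edge (d : direction) (v : Z3) : set Z3 :=
  let: (i, j, k) := v in
  match d with
  | da => [set (i, j - 1, k); (i, j, k - 1)]
  | db => [set (i - 1, j, k); (i, j, k - 1)]
  | dc => [set (i - 1, j, k); (i, j - 1, k)]
  end.

Definition short_edge (d : direction) (v : Z3) : set Z3 :=
  let: (i, j, k) := v in
  match d with
  | da => [set (i, j, k); (i, j - 1, k - 1)]
  | db => [set (i, j, k); (i - 1, j, k - 1)]
  | dc => [set (i, j, k); (i - 1, j - 1, k)]
  end.

(* The pair [(d, v)] is determined by the set [rhombus d v], so rhombi are
   quantified over through such pairs. *)
Definition is_rhombus (I : set Z3) (d : direction) (v : Z3) : Prop :=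
  rhombus d v `<=` I.

Definition rhombus_edges (I : set Z3) : set (set Z3) :=
  [set e | exists d v, is_rhombus I d v /\ (e = long_edge d v \/ e = short_edge d v)].

Lemma rhombus_edges_wf (I : set Z3) (e : set Z3) : rhombus_edges I e ->
  exists u v, [/\ u <> v, I u, I v & e = [set u; v]].
Proof.
move=> [d [[[i j] k] [rI [->|->]]]]; case: d rI => rI;
  (do 2 eexists; split; last reflexivity);
  by [case; lia | apply: rI; rewrite /=; tauto].
Qed.

Definition rhombus_graph (I : set Z3) : graph Z3 :=
  Graph (@rhombus_edges_wf I).

(* Being a family of sets, it identifies members given by different
   parameters, e.g. the last three constructors at [q = 0]. *)
Inductive boundary (N : int) : set (set Z3) :=
| boundary_ab (p q : int) of q < p < 0 & p + q = - N - 1 \/ p + q = - N - 2 :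
    boundary N [set (0, p, q); (p, 0, q)]
| boundary_ac (p q : int) of q < p < 0 & p + q = - N - 1 \/ p + q = - N - 2 :
    boundary N [set (p, q, 0); (0, q, p)]
| boundary_bc (p q : int) of q < p < 0 & p + q = - N - 1 \/ p + q = - N - 2 :
    boundary N [set (q, 0, p); (q, p, 0)]
| boundary_abc (p : int) of 2 * p = - N - 1 \/ 2 * p = - N - 2 :
    boundary N [set (0, p, p); (p, 0, p); (p, p, 0)]
| boundary_c (q : int) of q <= - N - 1 : boundary N [set (0, 0, q)]
| boundary_b (q : int) of q <= - N - 1 : boundary N [set (0, q, 0)]
| boundary_a (q : int) of q <= - N - 1 : boundary N [set (q, 0, 0)].

Record grove (I : set Z3) (N : int) (G : graph Z3) : Prop := Grove {
  grove_subgraph : subgraph G (rhombus_graph I);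
  grove_vertices : vertices G = I;
  grove_rhombus : forall d v, is_rhombus I d v ->
    (edges G (long_edge d v) /\ ~ edges G (short_edge d v)) \/
    (~ edges G (long_edge d v) /\ edges G (short_edge d v));
  grove_outside : forall d v, is_rhombus I d v ->
    (forall w, rhombus d v w -> coord_sum w < - N) ->
    edges G (short_edge d v);
  grove_component : forall K, component G K ->
    exists! S, boundary N S /\ S `<=` K;
  grove_boundary : forall S, boundary N S ->
    exists2 K, component G K & S `<=` K
}.

(* Main.v *)
(* Projected along (1, 1, 1), the rhombi tile the plane, and the two diagonals
   of a rhombus cross each other. For a cycle c of G, let f v be the parity of
   the number of edges of c crossed by a ray from v that follows rhombus
   diagonals. Across each diagonal, f changes exactly when the other diagonal
   of the rhombus lies on c. Since G has only one of the two diagonals, f is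
   constant on each component of G. Every component meets the boundary, where
   the short edges outside radius N lead to points whose rays miss c, so f = 0;
   but f changes across the diagonals dual to the edges of c. *)
Require Import Defs.
From mathcomp Require Import all_boot all_order all_algebra.
From mathcomp Require Import boolp classical_sets cardinality.
From mathcomp Require Import zify.

Set Implicit Arguments.
Unset Strict Implicit.
Unset Printing Implicit Defensive.

Import Order.TTheory GRing.Theory Num.Theory.
Local Open Scope classical_set_scope.
Local Open Scope ring_scope.

(** * Unordered pairs and degrees modulo 2 *)

Lemma set2_inj (T : Type) (a b c d : T) : [set a; b] = [set c; d] ->
  (a = c /\ b = d) \/ (a = d /\ b = c).
Proof.
move=> E.
have : [set c; d] a by rewrite -E; left.
have : [set c; d] b by rewrite -E; right.
have : [set a; b] c by rewrite E; left.
have : [set a; b] d by rewrite E; right.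
by move=> [] ? [] ? [] ? [] ?; subst; tauto || by [left|right].
Qed.

(** The twelve offsets are those of all long and short edges, so [star (z (i, j, k)) i j k] is the
    degree modulo 2 of [(i, j, k)] in [z]. *)
Definition star (g : Z3 -> bool) (i j k : int) : bool :=
  \big[addb/false]_(v <- [::
    (i, j - 1, k - 1); (i, j + 1, k - 1); (i, j - 1, k + 1); (i, j + 1, k + 1);
    (i - 1, j, k - 1); (i + 1, j, k - 1); (i - 1, j, k + 1); (i + 1, j, k + 1);
    (i - 1, j - 1, k); (i + 1, j - 1, k); (i - 1, j + 1, k); (i + 1, j + 1, k)])
  g v.

(** * Rhombi as faces of the order ideal *)

Section Rhombi.
Variable L : set Z3.
Hypothesis L_ideal : order_ideal L.
Notation l v := `[< L v >].

Lemma ideal_le i j k i' j' k' : l (i, j, k) ->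
  i' <= i -> j' <= j -> k' <= k -> l (i', j', k').
Proof. by move=> /asboolP /L_ideal LC *; apply/asboolP/LC. Qed.

(** The top corner dominates the others, and among the corners shifted by (1, 1, 1) the least is
    [(i + 1, j, k)]; the ideal property does the rest. *)
Lemma rhombus_daE i j k : is_rhombus (initial L) da (i, j, k) <->
  l (i, j, k) && ~~ l (i + 1, j, k).
Proof.
split.
  move=> R; have [_] : initial L (i, j - 1, k - 1) by apply: R; right.
  have [? _] : initial L (i, j, k) by apply: R; do 3 left.
  by rewrite !subrK => ?; apply/andP; split; [apply/asboolP|apply/asboolPn].
move=> /andP[Lv Lv1] w /= Rw; split.
  by apply/asboolP; move: Rw => -[[[]|]|] ->; apply: (ideal_le Lv); lia.
by move: Rw => -[[[]|]|] -> /asboolP Lw; case/negP: Lv1; apply: (ideal_le Lw); lia.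
Qed.

Lemma rhombus_dbE i j k : is_rhombus (initial L) db (i, j, k) <->
  l (i, j, k) && ~~ l (i, j + 1, k).
Proof.
split.
  move=> R; have [_] : initial L (i - 1, j, k - 1) by apply: R; right.
  have [? _] : initial L (i, j, k) by apply: R; do 3 left.
  by rewrite !subrK => ?; apply/andP; split; [apply/asboolP|apply/asboolPn].
move=> /andP[Lv Lv1] w /= Rw; split.
  by apply/asboolP; move: Rw => -[[[]|]|] ->; apply: (ideal_le Lv); lia.
by move: Rw => -[[[]|]|] -> /asboolP Lw; case/negP: Lv1; apply: (ideal_le Lw); lia.
Qed.

Lemma rhombus_dcE i j k : is_rhombus (initial L) dc (i, j, k) <->
  l (i, j, k) && ~~ l (i, j, k + 1).
Proof.
split.
  move=> R; have [_] : initial L (i - 1, j - 1, k) by apply: R; right.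
  have [? _] : initial L (i, j, k) by apply: R; do 3 left.
  by rewrite !subrK => ?; apply/andP; split; [apply/asboolP|apply/asboolPn].
move=> /andP[Lv Lv1] w /= Rw; split.
  by apply/asboolP; move: Rw => -[[[]|]|] ->; apply: (ideal_le Lv); lia.
by move: Rw => -[[[]|]|] -> /asboolP Lw; case/negP: Lv1; apply: (ideal_le Lw); lia.
Qed.

End Rhombi.

(** * Possible edges at a given point *)

Section Neighbors.
Variable L : set Z3.
Hypothesis L_ideal : order_ideal L.
Variables i j k : int.
Notation l v := `[< L v >].

(** In each direction [(i, j, k)] can be any of the four corners of a rhombus. The conditions are
    those for that rhombus to exist, minus what [(i, j, k)] in [initial L] already gives. *)
Inductive neighbor : Z3 -> Prop :=
| neighbor_a_top of ~~ l (i + 1, j, k) : neighbor (i, j - 1, k - 1)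
| neighbor_a_left of l (i, j + 1, k) & ~~ l (i + 1, j + 1, k) :
    neighbor (i, j + 1, k - 1)
| neighbor_a_right of l (i, j, k + 1) & ~~ l (i + 1, j, k + 1) :
    neighbor (i, j - 1, k + 1)
| neighbor_a_bottom of l (i, j + 1, k + 1) : neighbor (i, j + 1, k + 1)
| neighbor_b_top of ~~ l (i, j + 1, k) : neighbor (i - 1, j, k - 1)
| neighbor_b_left of l (i + 1, j, k) & ~~ l (i + 1, j + 1, k) :
    neighbor (i + 1, j, k - 1)
| neighbor_b_right of l (i, j, k + 1) & ~~ l (i, j + 1, k + 1) :
    neighbor (i - 1, j, k + 1)
| neighbor_b_bottom of l (i + 1, j, k + 1) : neighbor (i + 1, j, k + 1)
| neighbor_c_top of ~~ l (i, j, k + 1) : neighbor (i - 1, j - 1, k)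
| neighbor_c_left of l (i + 1, j, k) & ~~ l (i + 1, j, k + 1) :
    neighbor (i + 1, j - 1, k)
| neighbor_c_right of l (i, j + 1, k) & ~~ l (i, j + 1, k + 1) :
    neighbor (i - 1, j + 1, k)
| neighbor_c_bottom of l (i + 1, j + 1, k) : neighbor (i + 1, j + 1, k).

Lemma rhombus_edges_neighbor v :
  rhombus_edges (initial L) [set (i, j, k); v] -> neighbor v.
Proof.
case: v => [[i' j'] k'] [d [[[p q] r] [R E]]].
case: d R E => R; [move/(rhombus_daE L_ideal): R|move/(rhombus_dbE L_ideal): R
  |move/(rhombus_dcE L_ideal): R] => /andP[R1 R2] [] E;
have [] := set2_inj E => -[[Ei Ej Ek] [? ? ?]]; subst i' j' k'; move: Ei Ej Ek;
rewrite ?(subrK, addrK) => Ei Ej Ek.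
(* Matching endpoints forces the top corner [(p, q, r)] to be [(i, j, k)] plus 0 or 1 in each
   coordinate. *)
all: first [have ? : p = i by lia | have ? : p = i + 1 by lia]; subst p.
all: first [have ? : q = j by lia | have ? : q = j + 1 by lia]; subst q.
all: first [have ? : r = k by lia | have ? : r = k + 1 by lia]; subst r.
all: by rewrite ?addrK; constructor.
Qed.

Lemma neighbor_cond v : neighbor v ->
  [/\ v = (i, j - 1, k - 1) -> ~~ l (i + 1, j, k),
      v = (i, j + 1, k - 1) -> l (i, j + 1, k) && ~~ l (i + 1, j + 1, k),
      v = (i, j - 1, k + 1) -> l (i, j, k + 1) && ~~ l (i + 1, j, k + 1) &
      v = (i, j + 1, k + 1) -> l (i, j + 1, k + 1)] /\
  [/\ v = (i - 1, j, k - 1) -> ~~ l (i, j + 1, k),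
      v = (i + 1, j, k - 1) -> l (i + 1, j, k) && ~~ l (i + 1, j + 1, k),
      v = (i - 1, j, k + 1) -> l (i, j, k + 1) && ~~ l (i, j + 1, k + 1) &
      v = (i + 1, j, k + 1) -> l (i + 1, j, k + 1)] /\
  [/\ v = (i - 1, j - 1, k) -> ~~ l (i, j, k + 1),
      v = (i + 1, j - 1, k) -> l (i + 1, j, k) && ~~ l (i + 1, j, k + 1),
      v = (i - 1, j + 1, k) -> l (i, j + 1, k) && ~~ l (i, j + 1, k + 1) &
      v = (i + 1, j + 1, k) -> l (i + 1, j + 1, k)].
Proof. by case=> *; do ![split] => E; first [assumption | by apply/andP | case: E; lia]. Qed.

(** The twelve points are distinct, so exactly one term is true. *)
Lemma star_neighbor v : neighbor v -> star (eq_op v) i j k = true.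
Proof. by case=> *; rewrite /star !big_cons big_nil !xpair_eqE; lia. Qed.

End Neighbors.

(** * Rays and crossing parities *)

Section Sweep.
Variable L : set Z3.
Notation l v := `[< L v >].

(* Every rhombus of [initial L] has the diagonals [{v, sweep v}] and
   [{(flanks v).1, (flanks v).2}] for exactly one [v] in [initial L]; the ray
   of [v] is the orbit of [v] under [sweep]. *)
Definition sweep (v : Z3) : Z3 :=
  let: (i, j, k) := v in
  if ~~ l (i + 1, j, k) then (i, j - 1, k - 1)
  else if l (i + 1, j + 1, k) then (i + 1, j + 1, k)
  else (i + 1, j, k - 1).

Definition flanks (v : Z3) : Z3 * Z3 :=
  let: (i, j, k) := v in
  if ~~ l (i + 1, j, k) then ((i, j - 1, k), (i, j, k - 1))
  else if l (i + 1, j + 1, k) then ((i + 1, j, k), (i, j + 1, k))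
  else ((i + 1, j, k), (i, j, k - 1)).

(** Invariant under (1, 1, 1), hence a coordinate on the projected plane; rays ascend along it. *)
Definition height (v : Z3) : int := v.1.1 - v.2.

Lemma height_flanks v :
  height v <= height (flanks v).1 /\ height v <= height (flanks v).2.
Proof.
case: v => [[i j] k]; rewrite /height /=.
by case: ifP => _ /=; [lia | case: ifP => _ /=; lia].
Qed.

Lemma height_sweep v : height v + 1 <= height (sweep v).
Proof.
case: v => [[i j] k]; rewrite /height /=.
by case: ifP => _ /=; [lia | case: ifP => _ /=; lia].
Qed.

Variable z : rel Z3.
Variables B D : int.
Hypothesis z_height : forall u v, z u v -> height u < B.
Hypothesis z_depth : forall u v, z u v -> D <= u.2.

(** [z] will be the edge relation of a cycle; a step of the ray crosses the other diagonal of its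
    rhombus. *)
Definition crossing (v : Z3) : bool := z (flanks v).1 (flanks v).2.

Fixpoint ray_parity (m : nat) (v : Z3) : bool :=
  if m is m'.+1 then crossing v (+) ray_parity m' (sweep v) else false.

(* Since [height] increases along the ray, the steps left out cross no edge
   of [z]. *)
Definition parity (v : Z3) : bool := ray_parity `|B - height v|%N v.

Lemma crossing_high v : B <= height v -> crossing v = false.
Proof.
by move=> Bv; apply/negP => /z_height; have [] := height_flanks v; lia.
Qed.

Lemma ray_parity_high m v : B <= height v -> ray_parity m v = false.
Proof.
elim: m v => //= m IH v Bv; rewrite crossing_high // IH //.
by have := height_sweep v; lia.
Qed.

Lemma ray_parity_stable m n v : B - height v <= m%:Z -> B - height v <= n%:Z ->
  ray_parity m v = ray_parity n v.
Proof.
elim: m n v => [|m IH] n v Bm Bn; first by rewrite !ray_parity_high //; lia.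
case: n Bn => [|n] Bn; first by rewrite !ray_parity_high //; lia.
by rewrite /= (IH n) //; have := height_sweep v; lia.
Qed.

Lemma parity_high v : B <= height v -> parity v = false.
Proof. exact: ray_parity_high. Qed.

(** The third coordinate never increases along a ray, and the flanks do not exceed it either. *)
Lemma parity_deep v : v.2 < D -> parity v = false.
Proof.
rewrite /parity; move: `|_|%N => m; elim: m v => //= m IH v vD.
rewrite IH ?addbF.
  apply/negP => /z_depth; case: v vD => [[i j] k] /=.
  by case: ifP => _ /=; [lia | case: ifP => _ /=; lia].
by case: v vD => [[i j] k] /=; case: ifP => _ /=; [lia | case: ifP => _ /=; lia].
Qed.

Lemma parity_sweep v : parity v (+) parity (sweep v) = crossing v.
Proof.
rewrite /parity; set p := `|_|%N; set q := `|_|%N.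
(* Lengths chosen so that, after one step from [v], both rays have the same tail, which cancels. *)
rewrite (@ray_parity_stable p (p + q).+1); [|lia..].
rewrite (@ray_parity_stable q (p + q)); [|lia..].
by rewrite /= -addbA addbb addbF.
Qed.

End Sweep.

(** * Parity changes across both diagonals of a rhombus *)

Section Duality.
Variable L : set Z3.
Hypothesis L_ideal : order_ideal L.
Notation l v := `[< L v >].
Variable z : rel Z3.
Variables B D : int.
Hypothesis z_height : forall u v, z u v -> height u < B.
Hypothesis z_depth : forall u v, z u v -> D <= u.2.
Hypothesis z_sym : symmetric z.
Hypothesis z_edge : forall u v, z u v -> rhombus_edges (initial L) [set u; v].
Hypothesis z_even : forall i j k, star (z (i, j, k)) i j k = false.
Notation f := (parity L z B).

(** Across the diagonal that the ray follows, the change holds by construction; this and the next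
    two lemmas are the three cases of [sweep]. *)
Lemma parity_a i j k : ~~ l (i + 1, j, k) ->
  f (i, j, k) (+) f (i, j - 1, k - 1) = z (i, j - 1, k) (i, j, k - 1).
Proof.
by move=> H; have := parity_sweep L z_height (i, j, k); rewrite /crossing /= H.
Qed.

Lemma parity_b i j k : l (i + 1, j, k) -> ~~ l (i + 1, j + 1, k) ->
  f (i, j, k) (+) f (i + 1, j, k - 1) = z (i + 1, j, k) (i, j, k - 1).
Proof.
move=> H /negbTE H'; have := parity_sweep L z_height (i, j, k).
by rewrite /crossing /= H H'.
Qed.

Lemma parity_c i j k : l (i + 1, j + 1, k) ->
  f (i, j, k) (+) f (i + 1, j + 1, k) = z (i + 1, j, k) (i, j + 1, k).
Proof.
move=> H; have := parity_sweep L z_height (i, j, k).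
have H' : l (i + 1, j, k) by apply: (ideal_le L_ideal H); lia.
by rewrite /crossing /= H H'.
Qed.

(* Vanishes iff [parity] changes correctly across the diagonal [flanks v]; it is
   invariant under [sweep] because [z] has even degree at [sweep v]. *)
Definition defect (v : Z3) : bool :=
  z v (sweep L v) (+) f (flanks L v).1 (+) f (flanks L v).2.

Lemma z_neighbor i j k v : z (i, j, k) v -> neighbor L i j k v.
Proof. by move/z_edge; apply: rhombus_edges_neighbor. Qed.

Lemma initialE i j k :
  initial L (i, j, k) <-> l (i, j, k) && ~~ l (i + 1, j + 1, k + 1).
Proof.
split=> [[? ?]|/andP[/asboolP ? /asboolPn ?]] //.
by apply/andP; split; [apply/asboolP|apply/asboolPn].
Qed.

(* The right-hand side is the defect of the preimage of [(i, j, k)] under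
   [sweep]; the two differ by the degree of [z] at [(i, j, k)]. *)
Lemma defectE i j k : initial L (i, j, k) -> defect (i, j, k) =
  if ~~ l (i, j, k + 1) then
    z (i, j, k) (i - 1, j - 1, k) (+) f (i - 1, j, k) (+) f (i, j - 1, k)
  else if l (i, j + 1, k + 1) then
    z (i, j, k) (i, j + 1, k + 1) (+) f (i, j + 1, k) (+) f (i, j, k + 1)
  else z (i, j, k) (i - 1, j, k + 1) (+) f (i, j, k + 1) (+) f (i - 1, j, k).
Proof.
move/initialE => /andP[Lx Lx'].
have [i12 i13 i23] : [/\ l (i + 1, j + 1, k) -> l (i + 1, j, k) && l (i, j + 1, k),
    l (i + 1, j, k + 1) -> l (i + 1, j, k) && l (i, j, k + 1) &
    l (i, j + 1, k + 1) -> l (i, j + 1, k) && l (i, j, k + 1)].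
  by clear -L_ideal; split=> H; apply/andP; split; apply: (ideal_le L_ideal H); lia.
(* Six of the twelve possible edges at [(i, j, k)] are flank diagonals; [h1] to [h6] express [z]
   there as a change of [f]. *)
have h1 : l (i, j + 1, k) && ~~ l (i + 1, j + 1, k) ->
    f (i, j + 1, k) (+) f (i, j, k - 1) = z (i, j, k) (i, j + 1, k - 1).
  by move=> /andP[_ /parity_a]; rewrite addrK.
have h2 : l (i, j, k + 1) && ~~ l (i + 1, j, k + 1) ->
    f (i, j, k + 1) (+) f (i, j - 1, k) = z (i, j, k) (i, j - 1, k + 1).
  by move=> /andP[_ /parity_a]; rewrite addrK z_sym.
have h3 : ~~ l (i, j + 1, k) ->
    f (i - 1, j, k) (+) f (i, j, k - 1) = z (i, j, k) (i - 1, j, k - 1).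
  by move=> H; have := @parity_b (i - 1) j k; rewrite subrK; apply.
have h4 : l (i + 1, j, k + 1) ->
    f (i, j, k + 1) (+) f (i + 1, j, k) = z (i, j, k) (i + 1, j, k + 1).
  by move=> H; have := parity_b H Lx'; rewrite addrK z_sym.
have h5 : l (i + 1, j, k) && ~~ l (i + 1, j, k + 1) ->
    f (i, j - 1, k) (+) f (i + 1, j, k) = z (i, j, k) (i + 1, j - 1, k).
  by move=> /andP[H _]; have := @parity_c i (j - 1) k; rewrite subrK z_sym; apply.
have h6 : l (i, j + 1, k) && ~~ l (i, j + 1, k + 1) ->
    f (i - 1, j, k) (+) f (i, j + 1, k) = z (i, j, k) (i - 1, j + 1, k).
  by move=> /andP[H _]; have := @parity_c (i - 1) j k; rewrite subrK; apply.
have cond v zv := neighbor_cond (@z_neighbor i j k v zv).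
have [n1 n2 n3 n4] : [/\
    z (i, j, k) (i, j - 1, k - 1) -> ~~ l (i + 1, j, k),
    z (i, j, k) (i, j + 1, k - 1) -> l (i, j + 1, k) && ~~ l (i + 1, j + 1, k),
    z (i, j, k) (i, j - 1, k + 1) -> l (i, j, k + 1) && ~~ l (i + 1, j, k + 1) &
    z (i, j, k) (i, j + 1, k + 1) -> l (i, j + 1, k + 1)].
  by split=> /cond [[c1 c2 c3 c4] _]; auto.
have [n5 n6 n7 n8] : [/\
    z (i, j, k) (i - 1, j, k - 1) -> ~~ l (i, j + 1, k),
    z (i, j, k) (i + 1, j, k - 1) -> l (i + 1, j, k) && ~~ l (i + 1, j + 1, k),
    z (i, j, k) (i - 1, j, k + 1) -> l (i, j, k + 1) && ~~ l (i, j + 1, k + 1) &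
    z (i, j, k) (i + 1, j, k + 1) -> l (i + 1, j, k + 1)].
  by split=> /cond [_ [[c1 c2 c3 c4] _]]; auto.
have [n9 n10 n11 n12] : [/\
    z (i, j, k) (i - 1, j - 1, k) -> ~~ l (i, j, k + 1),
    z (i, j, k) (i + 1, j - 1, k) -> l (i + 1, j, k) && ~~ l (i + 1, j, k + 1),
    z (i, j, k) (i - 1, j + 1, k) -> l (i, j + 1, k) && ~~ l (i, j + 1, k + 1) &
    z (i, j, k) (i + 1, j + 1, k) -> l (i + 1, j + 1, k)].
  by split=> /cond [_ [_ [c1 c2 c3 c4]]]; auto.
(* These rewrite each value of [z] as guarded by the existence of its rhombus, with the change of
   [f] in its place for flank diagonals. *)
have and_imp (b c : bool) : (c -> b) -> c = b && c by case: b c => [] [] // ->.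
have and_eq (b c d : bool) : (c -> b) -> (b -> d = c) -> c = b && d.
  by case: b c d => [] [] [] // cb bd; [rewrite bd | rewrite -bd | rewrite cb | rewrite cb].
have -> : defect (i, j, k) =
    if ~~ l (i + 1, j, k) then
      z (i, j, k) (i, j - 1, k - 1) (+) f (i, j - 1, k) (+) f (i, j, k - 1)
    else if l (i + 1, j + 1, k) then
      z (i, j, k) (i + 1, j + 1, k) (+) f (i + 1, j, k) (+) f (i, j + 1, k)
    else z (i, j, k) (i + 1, j, k - 1) (+) f (i + 1, j, k) (+) f (i, j, k - 1).
  by rewrite /defect /=; case: ifP => _ //; case: ifP.
have := z_even i j k; rewrite /star !big_cons big_nil.
rewrite (and_imp _ _ n1) (and_eq _ _ _ n2 h1) (and_eq _ _ _ n3 h2).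
rewrite (and_imp _ _ n4) (and_eq _ _ _ n5 h3) (and_imp _ _ n6).
rewrite (and_imp _ _ n7) (and_eq _ _ _ n8 h4) (and_imp _ _ n9).
rewrite (and_eq _ _ _ n10 h5) (and_eq _ _ _ n11 h6) (and_imp _ _ n12).
(* What remains is Boolean in six memberships, six values of [f] and six of [z]; the ideal property
   rules out some membership patterns. *)
move: (l (i + 1, j, k)) (l (i, j + 1, k)) (l (i, j, k + 1)) (l (i + 1, j + 1, k))
  (l (i + 1, j, k + 1)) (l (i, j + 1, k + 1)) i12 i13 i23.
move: (f (i - 1, j, k)) (f (i + 1, j, k)) (f (i, j - 1, k)) (f (i, j + 1, k))
  (f (i, j, k - 1)) (f (i, j, k + 1)) => f1 f1' f2 f2' f3 f3'.
move: (z _ (i, j - 1, k - 1)) (z _ (i, j + 1, k + 1)) (z _ (i + 1, j, k - 1))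
  (z _ (i - 1, j, k + 1)) (z _ (i - 1, j - 1, k)) (z _ (i + 1, j + 1, k)).
clear => a1 a2 b1 b2 c1 c2 p1 p2 p3 m12 m13 m23.
case: p1 p2 p3 m12 m13 m23 => [] [] [] [] [] [] /= i12 i13 i23;
  try by [move: (i12 isT) | move: (i13 isT) | move: (i23 isT)].
all: clear; lia.
Qed.

Lemma sweep_initial v : initial L v -> initial L (sweep L v).
Proof.
case: v => [[i j] k] /initialE /andP[Lv Lv'] /=.
case: ifP => [H|/negbFE H1]; first by apply/initialE; rewrite !subrK H (ideal_le L_ideal Lv) //; lia.
case: ifP => H; apply/initialE.
  by rewrite H; apply: contra Lv' => H'; apply: (ideal_le L_ideal H'); lia.
rewrite subrK (ideal_le L_ideal H1) /=; [|lia..].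
by apply/negP => H'; case/negP: H; apply: (ideal_le L_ideal H'); lia.
Qed.

Lemma defect_sweep v : initial L v -> defect (sweep L v) = defect v.
Proof.
move=> Iv; have := sweep_initial Iv.
case: v Iv => [[i j] k] /initialE /andP[Lv /negbTE Lv'].
rewrite {2}/defect /=; case: ifP => [H|/negbFE H] Is.
  rewrite defectE // !subrK Lv (ideal_le L_ideal Lv) //=; last by lia.
  by rewrite z_sym -!addbA [X in _ (+) X]addbC.
move: Is; case: ifP => H' Is; rewrite defectE // ?(addrK, subrK) ?Lv' ?H ?H' /=.
  by rewrite z_sym -!addbA [X in _ (+) X]addbC.
by rewrite z_sym -!addbA [X in _ (+) X]addbC.
Qed.

(** High up the ray [z] and [f] both vanish, and invariance under [sweep] carries this back to
    [v]. *)
Lemma defect0 v : initial L v -> defect v = false.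
Proof.
have [n] : exists n : nat, B - height v <= n%:Z by exists `|B - height v|%N; lia.
elim: n v => [|n IH] v Bn Iv; last first.
  by rewrite -defect_sweep // IH; [|have := height_sweep L v; lia|exact: sweep_initial].
have hz w w' : B <= height w -> z w w' = false.
  by move=> Bw; apply/negP => /z_height; lia.
have [? ?] := height_flanks L v.
by rewrite /defect hz ?(parity_high L z_height) //; lia.
Qed.

(** The ray enters at the top corner for [da], at [(i - 1, j, k)] for [db] and at the bottom corner
    for [dc]; only for [db] does it follow the long diagonal. *)
Lemma rhombus_sweep d w : is_rhombus (initial L) d w -> exists2 v, initial L v &
  (long_edge d w = [set v; sweep L v] /\
     short_edge d w = [set (flanks L v).1; (flanks L v).2]) \/
  (short_edge d w = [set v; sweep L v] /\
     long_edge d w = [set (flanks L v).1; (flanks L v).2]).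
Proof.
case: w => [[i j] k]; case: d => R.
- move: (R) => /(rhombus_daE L_ideal)/andP[Lw Lw']; exists (i, j, k).
    by apply: R; do 3 left.
  by right; rewrite /= Lw'.
- move: (R) => /(rhombus_dbE L_ideal)/andP[Lw Lw']; exists (i - 1, j, k).
    by apply: R; left; left; right.
  by left; rewrite /= !subrK Lw (negbTE Lw').
- move: (R) => /(rhombus_dcE L_ideal)/andP[Lw Lw']; exists (i - 1, j - 1, k).
    by apply: R; right.
  right; rewrite /= !subrK Lw (ideal_le L_ideal Lw) //=; last by lia.
  by split; rewrite setUC.
Qed.

(** [parity_sweep] treats the diagonal followed by the ray and [defect0] the one crossed, so either
    diagonal may play the role of [e]. *)
Lemma rhombus_parity d w u v e : is_rhombus (initial L) d w ->
  ([set u; v] = long_edge d w /\ e = short_edge d w) \/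
  ([set u; v] = short_edge d w /\ e = long_edge d w) ->
  exists a b, [/\ initial L a, initial L b, e = [set a; b],
    f a (+) f b = z u v & f u (+) f v = z a b].
Proof.
move=> R E.
have : rhombus_edges (initial L) e.
  by exists d, w; split=> //; case: E => [] [_ ->]; [right|left].
move=> /rhombus_edges_wf [a [b [_ Ia Ib eE]]]; exists a, b.
have fz p q r s : [set p; q] = [set r; s] ->
    f p (+) f q = f r (+) f s /\ z p q = z r s.
  by move=> E'; have [] := set2_inj E' => -[-> ->] //; rewrite addbC z_sym.
have [x Ix H] := rhombus_sweep R.
have fx := parity_sweep L z_height x.
have fx' : f (flanks L x).1 (+) f (flanks L x).2 = z x (sweep L x).
  by move: (defect0 Ix); rewrite /defect -addbA; case: (z _ _) => //= /negbFE.
case: E => -[E E']; case: H => -[H1 H2]; rewrite H1 in E E' *; rewrite H2 in E E'.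
all: rewrite eE in E'; have [F1 F2] := fz _ _ _ _ E; have [F3 F4] := fz _ _ _ _ E'.
all: by split=> //; rewrite ?F1 ?F2 ?F3 ?F4.
Qed.

(** * Vanishing of the parity on a grove *)

Variables (N : int) (G : graph Z3).
Hypothesis L_sub : L `<=` C (0, 0, 0).
Hypothesis N_cutoff : cutoff (initial L) N.
Hypothesis G_grove : grove (initial L) N G.
Hypothesis z_grove : forall u v, z u v -> edges G [set u; v].

Lemma parity_adj u v : adj G u v -> f u = f v.
Proof.
move=> /asboolP uv; have [_ /(_ _ uv) [d [w [R E]]]] := grove_subgraph G_grove.
suff [e nGe H] : exists2 e, ~ edges G e &
    ([set u; v] = long_edge d w /\ e = short_edge d w) \/
    ([set u; v] = short_edge d w /\ e = long_edge d w).
  have [a [b [_ _ eE _]]] := rhombus_parity R H.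
  have -> : z a b = false by apply/negP => /z_grove; rewrite -eE.
  by case: (f u) (f v) => [] [].
have := grove_rhombus G_grove R; case: E => E; rewrite -E => -[] [].
- by exists (short_edge d w) => //; left.
- by move=> /(_ uv).
- by move=> _ /(_ uv).
- by exists (long_edge d w) => //; right.
Qed.

Lemma parity_connected u v : connected_in G u v -> f u = f v.
Proof.
move=> [p]; elim: p u => [|w p IH] u /=; first by move=> _ ->.
by move=> /andP[/parity_adj -> ?] ?; apply: IH.
Qed.

(* The short edges outside radius N lead from such a point to points of
   arbitrarily small third coordinate, where the rays miss the cycle. *)
Lemma parity_boundary i j k : i + j + k < - N -> coord_max (i, j, k) = 0 ->
  i = 0 \/ j = 0 -> f (i, j, k) = false.
Proof.
have [n] : exists n : nat, k - D < n%:Z by exists `|k - D|.+1%N; lia.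
elim: n i j k => [|n IH] i j k kn ijkN ijk0 ij0.
  by apply: (parity_deep L B z_depth) => /=; lia.
rewrite /= in ijk0.
have initN a b c : a + b + c < - N -> Num.max a (Num.max b c) = 0 ->
    initial L (a, b, c).
  by move=> *; apply: N_cutoff.1 => //=; lia.
(* A rhombus in the plane [i = 0] or [j = 0] has a short edge that lowers [k]; in the plane [k = 0]
   it would not. *)
case: ij0 => ?; [subst i|subst j].
  have R : is_rhombus (initial L) da (0, j, k).
    by move=> w /= [[[]|]|] ->; apply: initN; lia.
  have : adj G (0, j, k) (0, j - 1, k - 1).
    apply/asboolP/(grove_outside G_grove R) => w /= [[[]|]|] -> /=; lia.
  by move/parity_adj=> ->; apply: IH => /=; lia.
have R : is_rhombus (initial L) db (i, 0, k).
  by move=> w /= [[[]|]|] ->; apply: initN; lia.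
have : adj G (i, 0, k) (i - 1, 0, k - 1).
  apply/asboolP/(grove_outside G_grove R) => w /= [[[]|]|] -> /=; lia.
by move/parity_adj=> ->; apply: IH => /=; lia.
Qed.

(* For negative [N] some of the listed sets lie outside [C (0, 0, 0)]. *)
Lemma boundary_point S : boundary N S -> S `<=` C (0, 0, 0) -> exists i j k,
  [/\ S (i, j, k), i + j + k < - N, coord_max (i, j, k) = 0 & i = 0 \/ j = 0].
Proof.
case=> [p q|p q|p q|p|q|q|q].
- move=> ? ? _; exists 0, p, q; split=> /=; [by left|lia|lia|by left].
- move=> ? ? _; exists 0, q, p; split=> /=; [by right|lia|lia|by left].
- move=> ? ? _; exists q, 0, p; split=> /=; [by left|lia|lia|by right].
- move=> ? /(_ (0, p, p)) SC; exists 0, p, p.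
  have [] : C (0, 0, 0) (0, p, p) by apply: SC; left; left.
  by split=> /=; [left; left|lia|lia|left].
- move=> ? /(_ _ erefl) [? ? ?].
  by exists 0, 0, q; split=> /=; [|lia|lia|left].
- move=> ? /(_ _ erefl) [? ? ?].
  by exists 0, q, 0; split=> /=; [|lia|lia|left].
- move=> ? /(_ _ erefl) [? ? ?].
  by exists q, 0, 0; split=> /=; [|lia|lia|right].
Qed.

Lemma adj_initial u v : adj G u v -> initial L v.
Proof.
move=> /asboolP uv; have [_ /(_ _ uv)] := grove_subgraph G_grove.
by move=> /rhombus_edges_wf[a [b [_ Ia Ib E]]]; have [] := set2_inj E => -[_ ->].
Qed.

Lemma connected_initial u v : initial L u -> connected_in G u v -> initial L v.
Proof.
move=> Iu [p]; elim: p u Iu => [|w p IH] u Iu /=; first by move=> _ <-.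
by move=> /andP[/adj_initial Iw] ? ?; apply: IH Iw _ _.
Qed.

Lemma parity0 v : initial L v -> f v = false.
Proof.
move=> Iv; pose K := [set w | connected_in G v w].
have K_comp : component G K by exists v => //; rewrite (grove_vertices G_grove).
have [S [[bS SK] _]] := grove_component G_grove K_comp.
have SC : S `<=` C (0, 0, 0) by move=> w /SK /(connected_initial Iv) [/L_sub].
have [i [j [k [Sw ? ? ?]]]] := boundary_point bS SC.
by rewrite (parity_connected (SK _ Sw)) parity_boundary.
Qed.

(** An edge of [z] would make [f] differ at the ends of the dual diagonal, where it is zero. *)
Lemma even_subgraph_empty u v : z u v = false.
Proof.
apply/negP => zuv; have [d [w [R E]]] := z_edge zuv.
have [e H] : exists e,
    ([set u; v] = long_edge d w /\ e = short_edge d w) \/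
    ([set u; v] = short_edge d w /\ e = long_edge d w).
  by case: E => ?; [exists (short_edge d w); left|exists (long_edge d w); right].
have [a [b [Ia Ib _ + _]]] := rhombus_parity R H.
by rewrite zuv !parity0.
Qed.

End Duality.

(** * The edge relation of a cycle *)

Section Cycle.
Variable T : eqType.
Variable c : seq T.
Hypothesis c_uniq : uniq c.

(** For more than two distinct entries, exclusive or agrees with or; it lets degrees modulo 2 split
    into a [next] and a [prev] part. *)
Definition cycle_edge (u v : T) : bool :=
  [&& u \in c, v \in c & (next c u == v) (+) (next c v == u)].

Lemma cycle_edge_sym : symmetric cycle_edge.
Proof. by move=> u v; rewrite /cycle_edge addbC andbCA. Qed.

Lemma cycle_edge_adj (e : rel T) u v : symmetric e -> cycle e c ->
  cycle_edge u v -> e u v.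
Proof.
move=> e_sym ec /and3P[uc vc].
case: eqP => [<- _|_ /= /eqP <-]; first exact: next_cycle.
by rewrite e_sym; apply: next_cycle.
Qed.

Lemma cycle_edgeE u : u \in c ->
  cycle_edge u =1 (fun v => (next c u == v) (+) (prev c u == v)).
Proof.
move=> uc v; rewrite /cycle_edge uc /=; case: (boolP (v \in c)) => vc /=.
  by congr (_ (+) _); apply/eqP/eqP => <-; rewrite ?prev_next ?next_prev.
by do 2 (case: eqP => [E|_]; first by rewrite -E ?mem_next ?mem_prev uc in vc).
Qed.

Lemma cycle_edge_exists : (2 < size c)%N -> exists u v, cycle_edge u v.
Proof.
rewrite /cycle_edge; case: c c_uniq => [|x [|y [|w s]]] //= /and4P[].
(* The successor of [y] is the third entry [w], distinct from [x], so the two terms do not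
   cancel. *)
rewrite !inE !negb_or => /and3P[xy xw _] _ _ _ _.
by exists x, y; rewrite !inE !eqxx /= orbT /= (eq_sym y x) (negbTE xy) eq_sym.
Qed.

End Cycle.

(** * A cycle in a grove as an even subgraph *)

Lemma seq_int_bound (T : eqType) (g : T -> int) (s : seq T) :
  exists B : int, forall x, x \in s -> g x < B.
Proof.
elim: s => [|x s [B IH]]; first by exists 0.
exists (Num.max B (g x + 1)) => y; rewrite inE => /predU1P[->|/IH]; lia.
Qed.

Theorem theorem2 (L : set Z3) (N : int) (G : graph Z3)
    (L_ideal : order_ideal L)
    (L_sub : L `<=` C (0, 0, 0))
    (U_fin : finite_set (upper L `&` C (0, 0, 0)))
    (N_cutoff : cutoff (initial L) N)
    (G_grove : grove (initial L) N G) :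
  acyclic G.
Proof.
move=> c c2 /andP[c_cycle c_uniq].
have [u [v cuv]] := cycle_edge_exists c_uniq c2.
have adj_sym : symmetric (adj G) by move=> x y; rewrite /adj setUC.
have c_adj x y : cycle_edge c x y -> edges G [set x; y].
  by move/(cycle_edge_adj adj_sym c_cycle)/asboolP.
have [B c_height] := seq_int_bound height c.
(* An upper bound on the negated third coordinate, so [- D] bounds the depth from below. *)
have [D c_depth] := seq_int_bound (fun x : Z3 => - x.2) c.
suff : cycle_edge c u v = false by rewrite cuv.
apply: (@even_subgraph_empty L L_ideal (cycle_edge c) B (- D) _ _ _ _ _ N G) => //.
- by move=> x y /and3P[/c_height].
- by move=> x y /and3P[/c_depth]; lia.
- exact: cycle_edge_sym.
- by move=> x y /c_adj; have [_] := grove_subgraph G_grove; apply.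
(* Even degree: off the cycle every term is false; on it, successor and predecessor each contribute
   one. *)
move=> i j k; case: (boolP ((i, j, k) \in c)) => xc; last first.
  by rewrite /star big1 // => w _; rewrite /cycle_edge (negbTE xc).
have nb w : adj G (i, j, k) w -> star (eq_op w) i j k = true.
  move=> /asboolP; have [_ GI] := grove_subgraph G_grove.
  by move/GI/(rhombus_edges_neighbor L_ideal)/star_neighbor.
have -> : star (cycle_edge c (i, j, k)) i j k =
    star (eq_op (next c (i, j, k))) i j k (+) star (eq_op (prev c (i, j, k))) i j k.
  by rewrite /star -big_split; apply: eq_bigr => w _; exact: cycle_edgeE.
rewrite !nb //; last exact: next_cycle.
by rewrite adj_sym; apply: prev_cycle.
Qed.
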